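(* Let $n\ge2$ and let $V={\rm Sec}((\mathbb{P}^1)^{\times n})\cap\{x_\emptyset=1\}$. The $3\times3$ minors of all flattening matrices $M^x_{I_1|I_2}$ (with $x_\emptyset=1$), where $I_1|I_2$ ranges over all partitions of $[n]=\{1,\dots,n\}$ into two nonempty blocks, generate the ideal of $V$ in $\mathbb{C}[x_I:\emptyset\ne I\subseteq[n]]$.
   Context: The ground field is $\mathbb{C}$. Let $x_I$, $I\subseteq[n]$, be homogeneous coordinates on $\mathbb{P}^{2^n-1}$; $(\mathbb{P}^1)^{\times n}$ is Segre-embedded by $([a_1^1,a_1^2],\dots,[a_n^1,a_n^2])\mapsto[x_I=\prod_{i\in I}a_i^1\prod_{i\notin I}a_i^2]$, and ${\rm Sec}$ denotes the Zariski closure of the union of all lines joining pairs of distinct points. For a partition $I_1|I_2$ of $[n]$, the flattening $M^x_{I_1|I_2}$ is the matrix with rows indexed by all subsets $A\subseteq I_1$, columns indexed by all subsets $B\subseteq I_2$, and $(A,B)$ entry $x_{A\cup B}$. *)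

(* Defs.v *)
From HB Require Import structures.
From mathcomp Require Import all_boot all_order all_algebra.
From mathcomp Require Import mpoly complex reals.

Set Implicit Arguments.
Unset Strict Implicit.
Unset Printing Implicit Defensive.

Import GRing.Theory.
Local Open Scope ring_scope.

(* Polynomials in variables indexed by an arbitrary finType I: the variable of
   index i is 'X_(enum_rank i). *)
Section PolynomialRing.
Variables (F : fieldType) (I : finType).

Definition var (i : I) : {mpoly F[#|I|]} := 'X_(enum_rank i).

Definition evalp (f : {mpoly F[#|I|]}) (x : I -> F) : F :=
  f.@[fun k => x (enum_val k)].

Definition ideal_gen (S : {mpoly F[#|I|]} -> Prop) (f : {mpoly F[#|I|]}) :
    Prop :=
  exists2 s : seq ({mpoly F[#|I|]} * {mpoly F[#|I|]}),
    (forall hg, hg \in s -> S hg.2) & f = \sum_(hg <- s) hg.1 * hg.2.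

End PolynomialRing.

(* A subset of the projective space with homogeneous coordinates indexed by I
   is represented by the set of all the nonzero coordinate vectors of its
   points. *)
Section Projective.
Variables (F : fieldType) (I : finType).
Implicit Types (x p q : {ffun I -> F}) (S : {ffun I -> F} -> Prop).

Definition same_point p q : Prop := exists2 c : F, c != 0 & forall i, q i = c * p i.

Definition union_of_secant_lines S x : Prop :=
  x != 0 /\
  exists p q, [/\ S p, S q, ~ same_point p q &
    exists s t : F, forall i, x i = s * p i + t * q i].

Definition zariski_closure S x : Prop :=
  x != 0 /\
  forall (d : nat) (f : {mpoly F[#|I|]}), f \is d.-homog ->
    (forall y, S y -> evalp f y = 0) -> evalp f x = 0.

Definition Sec S := zariski_closure (union_of_secant_lines S).

End Projective.

Section SecantSegre.
Variables (F : fieldType) (n : nat).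

(* (a i).1 and (a i).2 are the homogeneous coordinates of the i-th factor. *)
Definition segre_map (a : 'I_n -> F * F) : {ffun {set 'I_n} -> F} :=
  [ffun A : {set 'I_n} =>
     (\prod_(i in A) (a i).1) * (\prod_(i | i \notin A) (a i).2)].

Definition segre (x : {ffun {set 'I_n} -> F}) : Prop :=
  exists2 a : 'I_n -> F * F,
    forall i, a i != (0, 0) & same_point (segre_map a) x.

Definition affine_secant (x : {ffun {set 'I_n} -> F}) : Prop :=
  Sec segre x /\ x set0 = 1.

Definition nonempty_subset := {A : {set 'I_n} | A != set0}.

Definition vanishing_ideal (V : {ffun {set 'I_n} -> F} -> Prop)
    (f : {mpoly F[#|{: nonempty_subset}|]}) : Prop :=
  forall x, V x -> evalp f (fun A : nonempty_subset => x (val A)) = 0.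

Definition flattening (T : Type) (x : {set 'I_n} -> T) (I1 I2 : {set 'I_n}) :
    'M[T]_(#|powerset I1|, #|powerset I2|) :=
  \matrix_(A, B) x (enum_val A :|: enum_val B).

(* The coordinate x_A on the chart x_set0 = 1. *)
Definition coord (A : {set 'I_n}) : {mpoly F[#|{: nonempty_subset}|]} :=
  if insub A is Some B then var F (B : nonempty_subset) else 1.

(* Rows and columns may be taken in any order, so each minor occurs with both
   signs; this does not affect the ideal generated. *)
Definition flattening_minor3 (g : {mpoly F[#|{: nonempty_subset}|]}) : Prop :=
  exists I1 I2 : {set 'I_n},
    [/\ I1 != set0, I2 != set0, I1 :|: I2 = setT, I1 :&: I2 = set0 &
      exists (r : 'I_3 -> 'I_#|powerset I1|) (c : 'I_3 -> 'I_#|powerset I2|),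
        [/\ injective r, injective c &
          g = \det (mxsub r c (flattening coord I1 I2))]].

End SecantSegre.

(* Main.v *)
Require Import Defs.
From mathcomp Require Import all_boot all_order all_algebra.
From mathcomp Require Import mpoly complex reals.
From mathcomp Require Import ring zify.

Set Implicit Arguments.
Unset Strict Implicit.
Unset Printing Implicit Defensive.

Import GRing.Theory Num.Theory.

(* Pass to central moments m_A, an automorphism of the polynomial ring.  On a
   secant point with weight u these are the means m_i and, for #|A| >= 2,
   m_A = u h(u) d^A with h(0) = 1, so as u -> 0 the variety degenerates to the
   toric one parametrized by m_A = u d^A.  In the ideal of minors, the 3 x 3 minors
   through the row and column of the empty set are, modulo terms of higher degree
   in the m_A (#|A| >= 2), the exchange binomials
     m_(A u B) m_(A' u B') - m_(A u B') m_(A' u B).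
   Exchanges connect any two families of sets of size >= 2 with the same number of
   members and the same incidences, so modulo the minors two monomials of equal
   multidegree and degree differ by terms of the same multidegree and higher
   degree.  If a polynomial vanishes on the secant variety, the coefficients in
   each class of its lowest-degree part sum to zero (divide by a power of u and
   set u = 0), so that part can be pushed to higher degree; the degree is bounded
   by the multidegree, so the process ends at 0. *)

(** * Connectivity of set families under exchanges *)

Section Connectivity.
Variable T : finType.
Implicit Types (A B I J U : {set T}) (s t : seq {set T}).

Definition plural A := 1 < #|A|.

Definition incidence s i := count (fun A => i \in A) s.

Lemma sum_card_incidence s : \sum_(A <- s) #|A| = \sum_i incidence s i.
Proof.
elim: s => [|A s IH]; first by rewrite big_nil big1.
rewrite big_cons IH /incidence /= big_split /= -sum1_card big_mkcond /=.
by congr (_ + _); apply: eq_bigr => i _; case: (i \in A).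
Qed.

Definition symdiff I U := (I :\: U) :|: (U :\: I).

(** The measure of progress: membership only moves from that of [I] to that of [U], and does so at
    [j]. *)
Lemma proper_symdiff I I' U j :
    (forall x, (x \in I') = (x \in I) \/ (x \in I') = (x \in U)) ->
    (j \in I) != (j \in U) -> (j \in I') = (j \in U) ->
  #|symdiff I' U| < #|symdiff I U|.
Proof.
move=> IU jI jI'; apply/proper_card/properP; split.
  by apply/subsetP => x; rewrite !inE; case: (IU x) => ->; case: (x \in U).
by exists j; rewrite !inE ?jI'; case: (j \in I) (j \in U) jI => [] [].
Qed.

(** An abstract congruence on families, later instantiated by [straightens]. The cardinality bounds
    in the two moves keep every member of size at least 2. *)
Variable E : seq {set T} -> seq {set T} -> Prop.
Hypothesis Etrans : forall s t u, E s t -> E t u -> E s u.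
Hypothesis Eperm : forall s t, perm_eq s t -> E s t.
Hypothesis Econs : forall A s t, plural A -> E s t -> E (A :: s) (A :: t).
Hypothesis Eincidence : forall s t, E s t -> incidence s =1 incidence t.
Hypothesis Esize : forall s t, E s t -> size s = size t.
Hypothesis Etransfer : forall I J s i, all plural s ->
  i \in I -> i \notin J -> 2 < #|I| -> 1 < #|J| ->
  E [:: I, J & s] [:: I :\ i, i |: J & s].
Hypothesis Eswap : forall I J s i j, all plural s ->
  i \in I -> i \notin J -> j \in J -> j \notin I -> 1 < #|I| -> 1 < #|J| ->
  E [:: I, J & s] [:: j |: (I :\ i), i |: (J :\ j) & s].

Let perm_second I r t : r \in t -> perm_eq (I :: t) [:: I, r & rem r t].
Proof. by move=> rt; rewrite perm_cons perm_to_rem. Qed.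

Let perm_swap2 I J t : perm_eq [:: I, J & t] [:: J, I & t].
Proof. exact/permPl/(perm_catCA [:: I] [:: J] t). Qed.

Let all_rem r t : all plural t -> all plural (rem r t).
Proof. by move/allP => bt; apply/allP => x /mem_rem /bt. Qed.

(** In this and the next two moves the new tail stays existential, because only the distance from
    the head to its target is tracked. *)
Lemma pull_into_head I t r j : all plural (I :: t) -> r \in t ->
    j \in r -> j \notin I -> 2 < #|r| ->
  exists2 t1, E (I :: t) ((j |: I) :: t1) & all plural ((j |: I) :: t1).
Proof.
move=> /= /andP[bI bt] rt jr jI r3; exists (r :\ j :: rem r t).
  apply: Etrans (Eperm (perm_second I rt)) _.
  apply: Etrans (Eperm (perm_swap2 _ _ _)) _.
  apply: Etrans (Etransfer _ jr jI r3 bI) _; first exact: all_rem.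
  exact/Eperm/perm_swap2.
rewrite /= all_rem // andbT /plural cardsU1 jI.
by move: r3 bI; rewrite /plural (cardsD1 j r) jr; lia.
Qed.

Lemma push_from_head I t q i : all plural (I :: t) -> q \in t ->
    i \in I -> i \notin q -> 2 < #|I| ->
  exists2 t1, E (I :: t) ((I :\ i) :: t1) & all plural ((I :\ i) :: t1).
Proof.
move=> /= /andP[bI bt] qt iI iq I3; exists (i |: q :: rem q t).
  apply: Etrans (Eperm (perm_second I qt)) _.
  by apply: Etransfer => //; [exact: all_rem | apply: (allP bt)].
rewrite /= all_rem // andbT /plural cardsU1 iq.
have := allP bt _ qt; move: I3; rewrite /plural (cardsD1 i I) iI; lia.
Qed.

Lemma swap_with_head I t q i j : all plural (I :: t) -> q \in t ->
    i \in I -> i \notin q -> j \in q -> j \notin I ->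
  exists2 t1, E (I :: t) ((j |: (I :\ i)) :: t1) &
              all plural ((j |: (I :\ i)) :: t1).
Proof.
move=> /= /andP[bI bt] qt iI iq jq jI; exists (i |: (q :\ j) :: rem q t).
  apply: Etrans (Eperm (perm_second I qt)) _.
  by apply: Eswap => //; [exact: all_rem | apply: (allP bt)].
rewrite /= all_rem // andbT /plural !cardsU1 !inE (negbTE jI) (negbTE iq).
have := allP bt _ qt; move: bI; rewrite /plural (cardsD1 i I) iI.
by rewrite (cardsD1 j q) jq !andbF; lia.
Qed.

(** If [U] is contained in [I], some element is pushed out of [I]. Otherwise some [j] of [U] is
    brought in, either pulled from a member with at least three elements or swapped against an [i]
    outside [U]. When neither is directly possible, an exchange inside the tail prepares it. *)
Lemma head_closer I t U t' :
    all plural (I :: t) -> all plural (U :: t') -> size t = size t' ->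
    incidence (I :: t) =1 incidence (U :: t') -> I != U ->
  exists I1 t1, [/\ E (I :: t) (I1 :: t1), all plural (I1 :: t1) &
                    #|symdiff I1 U| < #|symdiff I U|].
Proof.
move=> bIt bUt' szt inc neqIU.
(* The head contributes one occurrence of [i] on the left and none on the right, and the tails have
   equal size, so not all of [t] can contain [i]. *)
have avoid i : i \in I -> i \notin U -> exists2 q, q \in t & i \notin q.
  move=> iI iU; apply/hasP; rewrite has_predC all_count -/(incidence t i).
  have := inc i; rewrite {1 2}/incidence /= iI (negbTE iU) => e.
  have := count_size (fun A : {set T} => i \in A) t'.
  by rewrite -/(incidence _ _) -szt; move: e; rewrite /incidence; lia.
have closer I1 t1 j : E (I :: t) (I1 :: t1) -> all plural (I1 :: t1) ->
    (forall x, (x \in I1) = (x \in I) \/ (x \in I1) = (x \in U)) ->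
    (j \in I) != (j \in U) -> (j \in I1) = (j \in U) ->
    exists I1 t1, [/\ E (I :: t) (I1 :: t1), all plural (I1 :: t1) &
                    #|symdiff I1 U| < #|symdiff I U|].
  move=> EI bI h1 h2 h3; exists I1, t1; split=> //.
  exact: proper_symdiff h1 h2 h3.
have [/eqP|[j]] := set_0Vmem (U :\: I).
  rewrite setD_eq0 => sUI; have pUI : U \proper I.
    by rewrite properEneq eq_sym neqIU.
  have [_ [i iI iU]] := properP pUI; have [q qt iq] := avoid i iI iU.
  have I3 : 2 < #|I|.
    have /= /andP[bU _] := bUt'.
    exact: leq_ltn_trans bU (proper_card pUI).
  have [t1 E1 b1] := push_from_head bIt qt iI iq I3.
  apply: (closer _ _ i E1 b1); rewrite ?iI ?(negbTE iU) ?setD11 //.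
  by move=> x; rewrite !inE; case: eqP => [->|_]; [right; rewrite (negbTE iU) | left].
rewrite inE => /andP[jI jU].
have /hasP[r rt jr] : has (fun A : {set T} => j \in A) t.
  have := inc j; rewrite has_count /incidence /= jU (negbTE jI); lia.
have pull_done t0 r0 : E (I :: t) (I :: t0) -> all plural (I :: t0) ->
    r0 \in t0 -> j \in r0 -> 2 < #|r0| ->
    exists I1 t1, [/\ E (I :: t) (I1 :: t1), all plural (I1 :: t1) &
                    #|symdiff I1 U| < #|symdiff I U|].
  move=> E0 b0 r0t jr0 r03.
  have [t1 E1 b1] := pull_into_head b0 r0t jr0 jI r03.
  apply: (closer _ _ j (Etrans E0 E1) b1); rewrite ?jU ?(negbTE jI) ?setU11 //.
  by move=> x; rewrite !inE; case: eqP => [->|_]; [right; rewrite jU | left].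
have [r3|r2] := ltnP 2 #|r|; first exact: pull_done (Eperm (perm_refl _)) _ rt jr r3.
have bt : all plural t by case/andP: bIt.
have bI : plural I by case/andP: bIt.
have [/eqP|[ i ]] := set_0Vmem (I :\: U).
  (* Now [I] is a proper subset of [U]. Both families have the same total cardinality and [t'] has
     members of size at least 2, so some [r0] in [t] has at least three elements. Moving an element
     [y] of [r0] into the pair [r] makes [r] large enough to give up [j]. *)
  rewrite setD_eq0 => sIU.
  have ltIU : #|I| < #|U| by apply: proper_card; rewrite properEneq neqIU.
  have /hasP[r0 r0t r03] : has (fun A : {set T} => 2 < #|A|) t.
    apply/negPn/negP; rewrite -all_predC => /allP small.
    have : \sum_(A <- I :: t) #|A| = \sum_(A <- U :: t') #|A|.
      by rewrite !sum_card_incidence; apply: eq_bigr => i _; apply: inc.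
    rewrite !big_cons.
    have : \sum_(A <- t) #|A| <= \sum_(A <- t) 2.
      by rewrite big_seq [leqRHS]big_seq leq_sum // => A /small /=; rewrite -leqNgt.
    have : \sum_(A <- t') 2 <= \sum_(A <- t') #|A|.
      rewrite big_seq [leqRHS]big_seq leq_sum // => A.
      by case/andP: bUt' => _ /allP; apply.
    by rewrite !big_const_seq !count_predT !iter_addn_0 szt; move: ltIU; clear; lia.
  have /subsetPn[y yr0 yr] : ~~ (r0 \subset r).
    by apply: contraL r03 => /subset_leq_card r0r; rewrite -leqNgt (leq_trans r0r).
  have rem_r0 : r0 \in rem r t.
    apply: contraLR r0t; move=> r0r; have := perm_to_rem rt => /perm_mem ->.
    rewrite inE negb_or r0r andbT; apply: contraNneq yr => <- //.
  have b1 : all plural (r :: rem r t).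
    by rewrite -(perm_all _ (perm_to_rem rt)).
  have [t1 E1 b1'] := pull_into_head b1 rem_r0 yr0 yr r03.
  apply: (pull_done ((y |: r) :: t1) (y |: r)).
  - apply: Etrans (Eperm (perm_second I rt)) _; exact: Econs.
  - by rewrite [all _ _]/(_ && _) bI.
  - exact: mem_head.
  - by rewrite !inE jr orbT.
  - by rewrite cardsU1 yr; exact: (allP bt).
rewrite inE => /andP[iU iI].
have swap_done t0 q : E (I :: t) (I :: t0) -> all plural (I :: t0) ->
    q \in t0 -> i \notin q -> j \in q ->
    exists I1 t1, [/\ E (I :: t) (I1 :: t1), all plural (I1 :: t1) &
                    #|symdiff I1 U| < #|symdiff I U|].
  move=> E0 b0 qt iq jq.
  have [t1 E1 b1] := swap_with_head b0 qt iI iq jq jI.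
  apply: (closer _ _ j (Etrans E0 E1) b1); rewrite ?jU ?(negbTE jI) ?setU11 //.
  move=> x; rewrite !inE; case: eqP => [->|_]; first by right; rewrite jU.
  by case: eqP => [->|_]; [right; rewrite (negbTE iU) | left].
have Erefl : E (I :: t) (I :: t) by apply: Eperm.
have [ir|ir] := boolP (i \in r); last exact: swap_done Erefl _ rt ir jr.
have [q qt iq] := avoid i iI iU.
have [jq|jq] := boolP (j \in q); first exact: swap_done Erefl _ qt iq jq.
have neqij : i != j by apply: contraNneq jI => <-.
(* What remains is [r] equal to {i, j} and a [q] missing both. Swapping some [x] of [q] with the [j]
   of [r] yields a member containing [j] but not [i], as [swap_done] requires. *)
have r_eq : r = [set i; j].
  apply/esym/eqP; rewrite eqEcard cards2 neqij r2 andbT.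
  by apply/subsetP => x; rewrite !inE => /orP[] /eqP ->.
have [x xq] : exists x, x \in q.
  by apply/set0Pn; rewrite -card_gt0; exact: ltnW (allP bt _ qt).
have xr : x \notin r.
  by rewrite r_eq !inE; apply/norP; split; [apply: contraNneq iq|apply: contraNneq jq] => <-.
have rem_r : r \in rem q t.
  apply: contraLR rt => rq; have := perm_to_rem qt => /perm_mem ->.
  by rewrite inE negb_or rq andbT; apply: contraNneq iq => <-.
have b1 : all plural (q :: rem q t).
  by rewrite -(perm_all _ (perm_to_rem qt)).
have [t1 E1 b1'] := swap_with_head b1 rem_r xq xr jr jq.
apply: (swap_done (j |: (q :\ x) :: t1) (j |: (q :\ x))).
- apply: Etrans (Eperm (perm_second I qt)) _; exact: Econs.
- by rewrite [all _ _]/(_ && _) bI.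
- exact: mem_head.
- by rewrite !inE (negbTE iq) andbF orbF.
- by rewrite setU11.
Qed.

(** Induction on [s']: moves shrink the symmetric difference of the two heads until they agree, and
    then the common head is removed. *)
Lemma connectivity s s' : all plural s -> all plural s' ->
  size s = size s' -> incidence s =1 incidence s' -> E s s'.
Proof.
elim: s' s => [|U t' IH] [|I t] // bIt bUt'; first by move=> *; apply: Eperm.
move=> [szt] inc.
have [k] := ubnP #|symdiff I U|.
elim: k => // k IHk in I t bIt szt inc *; rewrite ltnS => lek.
have [eqIU|neqIU] := eqVneq I U.
  rewrite -{}eqIU in bUt' inc *; case/andP: bIt bUt' => bI bt /andP[_ bt'].
  apply: Econs => //; apply: IH => // i.
  by have := inc i; rewrite /incidence /=; apply: addnI.
have [I1 [t1 [E1 b1 lt1]]] := head_closer bIt bUt' szt inc neqIU.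
apply: (Etrans E1); apply: IHk => //; last exact: leq_trans lt1 lek.
  by have := Esize E1; rewrite /= szt => - [->].
by move=> i; rewrite -(Eincidence E1).
Qed.

End Connectivity.

Local Open Scope ring_scope.

(** * Central moments and minors *)

Section CentralMoments.
Variables (R : comNzRingType) (I : finType).
Implicit Types (x : {set I} -> R) (A B : {set I}).

Definition shift_coef x A B := \prod_(i in A :\: B) - x [set i].

(** If [x A] is read as the expectation of the product of the X_i over [A], this is the expanded
    expectation of the product of the X_i - E X_i. *)
Definition central x A := \sum_(B : {set I} | B \subset A) x B * shift_coef x A B.

Definition cov x A B := x (A :|: B) - x A * x B.

Lemma central_set0 x : x set0 = 1 -> central x set0 = 1.
Proof.
move=> x0; rewrite /central (big_pred1 set0) => [|B]; last exact: subset0.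
by rewrite x0 /shift_coef setD0 big_set0 mulr1.
Qed.

Lemma central_set1 x i : x set0 = 1 -> central x [set i] = 0.
Proof.
move=> x0; have i0 : [set i] != set0 by apply/set0Pn; exists i; apply: set11.
rewrite /central (bigD1 set0) ?sub0set //= (big_pred1 [set i]) => [|B]; last first.
  by rewrite subset1 andb_orl andbN orbF andb_idr // => /eqP ->.
by rewrite /shift_coef setDv setD0 big_set0 big_set1 x0; ring.
Qed.

Lemma central_setU x A B : [disjoint A & B] ->
  central x (A :|: B) =
  \sum_(A0 : {set I} | A0 \subset A) \sum_(B0 : {set I} | B0 \subset B)
     x (A0 :|: B0) * (shift_coef x A A0 * shift_coef x B B0).
Proof.
move=> dAB; rewrite /central pair_big_dep /=.
rewrite (reindex_onto (fun p : {set I} * {set I} => p.1 :|: p.2)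
                      (fun C => (C :&: A, C :&: B))) /=; last first.
  by move=> C CAB; rewrite -setIUr; apply/setIidPl.
apply: eq_big => [[C D]|[C D] /andP[_ /eqP[eC eD]]] /=.
  apply/andP/andP => [[_ /eqP[<- <-]]|[CA DB]]; first by rewrite !subsetIr.
  split; first exact: setUSS.
  rewrite !setIUl (setIidPl CA) (setIidPl DB).
  have -> : D :&: A = set0.
    by apply/disjoint_setI0/(disjointWl DB); rewrite disjoint_sym.
  by rewrite (disjoint_setI0 (disjointWl CA dAB)) setU0 set0U.
congr (_ * _); rewrite /shift_coef -bigU /=; last first.
  by apply: disjointWl (subsetDl _ _) (disjointWr (subsetDl _ _) dAB).
apply: eq_bigl => i; have CA : C \subset A by rewrite -eC subsetIr.
have DB : D \subset B by rewrite -eD subsetIr.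
have := @disjointFr _ _ _ i dAB; move/subsetP: CA => /(_ i); move/subsetP: DB => /(_ i).
rewrite !inE; case: (i \in C) (i \in D) (i \in A) (i \in B) => [] [] [] [] //=.
all: by move=> h1 h2 h3;
  first [by have := h1 isT | by have := h2 isT | by have := h3 isT].
Qed.

Lemma central_sum x A :
  central x A = \sum_(B : {set I} | B \subset A) shift_coef x A B * x B.
Proof. by apply: eq_bigr => B _; rewrite mulrC. Qed.

(** Since [shift_coef] is multiplicative over disjoint unions, passing to central moments acts on
    the covariance matrix by linear row and column operations. *)
Lemma cov_central x A B : [disjoint A & B] ->
  cov (central x) A B =
  \sum_(A0 : {set I} | A0 \subset A) shift_coef x A A0 *
    \sum_(B0 : {set I} | B0 \subset B) shift_coef x B B0 * cov x A0 B0.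
Proof.
move=> dAB; rewrite /cov central_setU // !central_sum big_distrlr -sumrB.
apply: eq_bigr => A0 _; rewrite -sumrB mulr_sumr; apply: eq_bigr => B0 _.
by rewrite /=; ring.
Qed.

Lemma cov0l x B : x set0 = 1 -> cov x set0 B = 0.
Proof. by move=> x0; rewrite /cov set0U x0 mul1r subrr. Qed.

Lemma cov0r x A : x set0 = 1 -> cov x A set0 = 0.
Proof. by move=> x0; rewrite /cov setU0 x0 mulr1 subrr. Qed.

(** What is left of a 3 x 3 flattening minor after the pivot [x set0], equal to 1, has cleared the
    row and column of the empty set. *)
Definition cov_minor x A A' B B' :=
  cov x A B * cov x A' B' - cov x A B' * cov x A' B.

Variable J : R -> Prop.
Hypothesis J0 : J 0.
Hypothesis JD : forall a b, J a -> J b -> J (a + b).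
Hypothesis JM : forall a b, J b -> J (a * b).

(** A 2 x 2 determinant is bilinear in its rows, so it expands into the determinants of the
    individual terms. *)
Lemma bilinear_minor (T : finType) (P P' : pred T) (w w' f g : T -> R) :
    (forall a a', P a -> P' a' -> J (f a * g a' - f a' * g a)) ->
  J ((\sum_(a | P a) w a * f a) * (\sum_(a | P' a) w' a * g a)
     - (\sum_(a | P' a) w' a * f a) * (\sum_(a | P a) w a * g a)).
Proof.
move=> Jfg; rewrite !big_distrlr [X in _ - X]exchange_big -sumrB.
apply: big_ind => // a Pa; rewrite -sumrB.
apply: big_ind => // a' Pa'.
rewrite [X in J X](_ : _ = w a * w' a' * (f a * g a' - f a' * g a)) /=.
  exact/JM/Jfg.
by ring.
Qed.

(** By [cov_central] this is bilinearity, used once for the rows and once for the columns. *)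
Lemma cov_minor_central x A A' B B' :
    [disjoint A :|: A' & B :|: B'] ->
    (forall A0 A0' B0 B0' : {set I}, A0 \subset A -> A0' \subset A' ->
      B0 \subset B -> B0' \subset B' -> J (cov_minor x A0 A0' B0 B0')) ->
  J (cov_minor (central x) A A' B B').
Proof.
move=> dAB Jx.
rewrite /cov_minor !cov_central; last first.
all: do ?by apply: disjointW dAB; rewrite ?subsetUl ?subsetUr.
rewrite [X in _ - X]mulrC.
apply: bilinear_minor => A0 A0' sA sA'.
rewrite [X in _ - X]mulrC; apply: bilinear_minor => B0 B0' sB sB'.
exact: Jx.
Qed.

End CentralMoments.

Section Ideal.
Variables (F : fieldType) (I : finType).
Implicit Types (S : {mpoly F[#|I|]} -> Prop) (f g : {mpoly F[#|I|]}).

Lemma ideal_gen0 S : ideal_gen S 0.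
Proof. by exists [::]; rewrite // big_nil. Qed.

Lemma ideal_genD S f g : ideal_gen S f -> ideal_gen S g -> ideal_gen S (f + g).
Proof.
move=> [s Ss ->] [t St ->]; exists (s ++ t); last by rewrite big_cat.
by move=> hg; rewrite mem_cat => /orP[/Ss|/St].
Qed.

Lemma ideal_genM S f g : ideal_gen S g -> ideal_gen S (f * g).
Proof.
move=> [s Ss ->]; exists [seq (f * hg.1, hg.2) | hg <- s].
  by move=> hg /mapP[hg' /Ss Shg' ->].
by rewrite big_map mulr_sumr; apply: eq_bigr => hg _; rewrite mulrA.
Qed.

Lemma ideal_gen_gen S f : S f -> ideal_gen S f.
Proof.
move=> Sf; exists [:: (1, f)]; last by rewrite big_seq1 mul1r.
by move=> hg; rewrite inE => /eqP ->.
Qed.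

End Ideal.

Lemma det_mx33 (R : comNzRingType) (M : 'M[R]_3) :
  \det M = M 0 0 * (M 1 1 * M 2%:R 2%:R - M 1 2%:R * M 2%:R 1)
         - M 0 1 * (M 1 0 * M 2%:R 2%:R - M 1 2%:R * M 2%:R 0)
         + M 0 2%:R * (M 1 0 * M 2%:R 1 - M 1 1 * M 2%:R 0).
Proof.
(* With entries indexed by [nat], the lifted ordinals of the cofactor expansion simply compute. *)
have [m ->] : exists m : nat -> nat -> R, M = \matrix_(i, j) m i j.
  exists (fun i j => M (inord i) (inord j)).
  by apply/matrixP => i j; rewrite mxE !inord_val.
rewrite (expand_det_row _ 0) !big_ord_recl big_ord0 /cofactor.
rewrite !(expand_det_row _ 0) !big_ord_recl !big_ord0 /cofactor !det_mx11.
rewrite !mxE /= /bump /=; ring.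
Qed.

(** * The ideal of minors in moment coordinates *)

Section Coordinates.
Variables (F : fieldType) (n : nat).
Local Notation N := #|{: nonempty_subset n}|.
Local Notation P := {mpoly F[N]}.
Local Notation x := (@Defs.coord F n).
Local Notation J := (ideal_gen (@flattening_minor3 F n)).
Implicit Types (A B : {set 'I_n}) (g : P).

Lemma coord_set0 : x set0 = 1.
Proof. by rewrite /Defs.coord insubF // eqxx. Qed.

Lemma coord_val (B : nonempty_subset n) : x (val B) = 'X_(enum_rank B).
Proof. by rewrite /Defs.coord valK. Qed.

Lemma evalp_coord (z : {set 'I_n} -> F) A : z set0 = 1 ->
  evalp (x A) (fun B : nonempty_subset n => z (val B)) = z A.
Proof.
move=> z0; have [->|A0] := eqVneq A set0; first by rewrite coord_set0 /evalp meval1.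
by rewrite -[A]/(val (exist _ A A0 : nonempty_subset n)) coord_val /evalp
           mevalXU enum_rankK.
Qed.

(** The expression is 0 if one of the sets is empty or if [A = A'] or [B = B']. Otherwise it is the
    minor with rows [set0], [A], [A'] and columns [set0], [B], [B'] of the flattening of [A :|: A']
    against its complement. *)
Lemma cov_minor_coord A A' B B' : [disjoint A :|: A' & B :|: B'] ->
  J (cov_minor x A A' B B').
Proof.
move=> dAB; have J0 := ideal_gen0 (@flattening_minor3 F n).
rewrite /cov_minor.
have [->|A0] := eqVneq A set0.
  by rewrite !(cov0l _ coord_set0) !mul0r subrr.
have [->|A'0] := eqVneq A' set0.
  by rewrite !(cov0l _ coord_set0) !mulr0 subrr.
have [->|B0] := eqVneq B set0.
  by rewrite !(cov0r _ coord_set0) mul0r mulr0 subrr.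
have [->|B'0] := eqVneq B' set0.
  by rewrite !(cov0r _ coord_set0) mul0r mulr0 subrr.
have [<-|AA'] := eqVneq A A'; first by rewrite mulrC subrr.
have [<-|BB'] := eqVneq B B'; first by rewrite subrr.
pose I1 := A :|: A'; pose I2 := ~: I1.
have AI : A \subset I1 by apply: subsetUl.
have A'I : A' \subset I1 by apply: subsetUr.
have BI : B \subset I2.
  by rewrite subsets_disjoint setCK disjoint_sym (disjointWr _ dAB) ?subsetUl.
have B'I : B' \subset I2.
  by rewrite subsets_disjoint setCK disjoint_sym (disjointWr _ dAB) ?subsetUr.
have emp (C : {set 'I_n}) : set0 \in powerset C by rewrite powersetE sub0set.
pose rs := [:: set0; A; A']; pose cs := [:: set0; B; B'].
pose r (i : 'I_3) := enum_rank_in (emp I1) (nth set0 rs i).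
pose c (i : 'I_3) := enum_rank_in (emp I2) (nth set0 cs i).
have rE i : enum_val (r i) = nth set0 rs i.
  rewrite enum_rankK_in // powersetE.
  by case: i => [[|[|[|]]]] //= _; rewrite sub0set.
have cE i : enum_val (c i) = nth set0 cs i.
  rewrite enum_rankK_in // powersetE.
  by case: i => [[|[|[|]]]] //= _; rewrite sub0set.
apply: ideal_gen_gen; exists I1, I2; split.
- by rewrite setU_eq0 negb_and A0.
- by apply: contraNneq B0 => I20; rewrite -subset0 -I20.
- exact: setUCr.
- exact: setICr.
exists r, c; split.
- move=> i j /(congr1 enum_val); rewrite !rE => /eqP.
  rewrite nth_uniq ?ltn_ord //=; first by move/eqP/val_inj.
  by rewrite !inE !negb_or ![set0 == _]eq_sym A0 A'0 AA'.
- move=> i j /(congr1 enum_val); rewrite !cE => /eqP.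
  rewrite nth_uniq ?ltn_ord //=; first by move/eqP/val_inj.
  by rewrite !inE !negb_or ![set0 == _]eq_sym B0 B'0 BB'.
rewrite det_mx33 !mxE !rE !cE /= !set0U !setU0 coord_set0 /cov.
by ring.
Qed.

(** Substituting this tuple ([theta] below) reads a polynomial as one in the means and the higher
    central moments. *)
Definition central_tuple : N.-tuple P := [tuple
  let A := val (enum_val k) in
  if (1 < #|A|)%N then central x A else x A | k < N].

(** Chosen so that [theta] sends it to [central x A] for every [A]: the central moments of order 0
    and 1 are the constants 1 and 0. *)
Definition big_coord A : P := if (1 < #|A|)%N then x A else (A == set0)%:R.

Local Notation theta := (comp_mpoly central_tuple).

Lemma thetaX (B : nonempty_subset n) : theta 'X_(enum_rank B) =
  if (1 < #|val B|)%N then central x (val B) else x (val B).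
Proof. by rewrite comp_mpolyXU -tnth_nth tnth_mktuple enum_rankK. Qed.

Lemma theta_big_coord A : theta (big_coord A) = central x A.
Proof.
rewrite /big_coord; case: ifPn => [A1|].
  have A0 : A != set0 by rewrite -card_gt0 ltnW.
  rewrite -[A in LHS]/(val (exist _ A A0 : nonempty_subset n)) coord_val thetaX.
  by rewrite /= A1.
rewrite -leqNgt; have [->|A0 A1] := eqVneq A set0.
  by rewrite rmorph1 central_set0 // coord_set0.
have /cards1P[i ->] : #|A| == 1%N by rewrite eqn_leq A1 card_gt0.
by rewrite rmorph0 central_set1 // coord_set0.
Qed.

Lemma theta_coord_small A : (#|A| <= 1)%N -> theta (x A) = x A.
Proof.
move=> A1; have [->|A0] := eqVneq A set0; first by rewrite coord_set0 rmorph1.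
rewrite -[A]/(val (exist _ A A0 : nonempty_subset n)) coord_val thetaX /=.
by rewrite ltnNge A1 -coord_val.
Qed.

Definition in_image g := exists f, theta f = g.

Let imageD f g : in_image f -> in_image g -> in_image (f + g).
Proof. by move=> [f' <-] [g' <-]; exists (f' + g'); rewrite rmorphD. Qed.

Let imageM f g : in_image f -> in_image g -> in_image (f * g).
Proof. by move=> [f' <-] [g' <-]; exists (f' * g'); rewrite rmorphM. Qed.

Let imageN f : in_image f -> in_image (- f).
Proof. by move=> [f' <-]; exists (- f'); rewrite rmorphN. Qed.

Let image0 : in_image 0. Proof. by exists 0; rewrite rmorph0. Qed.

Let image1 : in_image 1. Proof. by exists 1; rewrite rmorph1. Qed.

(** The substitution is unitriangular for inclusion: [central x A] is [x A] plus terms in the means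
    and in [x B] for proper subsets [B] of [A]. *)
Lemma coord_in_image A : in_image (x A).
Proof.
have [k] := ubnP #|A|; elim: k A => // k IH A; rewrite ltnS => Ak.
have [A1|A1] := leqP #|A| 1; first by exists (x A); apply: theta_coord_small.
have -> : x A = theta (big_coord A) -
    \sum_(B : {set 'I_n} | (B \subset A) && (B != A)) x B * shift_coef x A B.
  rewrite theta_big_coord /central (bigD1 A) //= /shift_coef setDv big_set0 mulr1.
  by rewrite addrK.
apply: imageD; first by exists (big_coord A).
apply: imageN; apply: big_ind => // B /andP[BA neqBA].
apply: imageM.
  by apply: IH; apply: leq_trans Ak; apply: proper_card; rewrite properEneq neqBA.
apply: big_ind => // i _.
apply: imageN; exists (x [set i]); apply: theta_coord_small.
by rewrite cards1.
Qed.

Lemma theta_surj g : in_image g.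
Proof.
rewrite [g]mpolyE; apply: big_ind => // m _.
rewrite -mul_mpolyC; apply: imageM.
  by exists (g@_m)%:MP; rewrite comp_mpolyC.
rewrite mpolyXE_id; apply: big_ind => // k _.
rewrite -(enum_valK k) -coord_val; elim: (m _) => [|e IHe]; first by rewrite expr0.
by rewrite exprS; apply: imageM => //; apply: coord_in_image.
Qed.

Lemma cov_minor_big_coord A A' B B' : [disjoint A :|: A' & B :|: B'] ->
  J (theta (cov_minor big_coord A A' B B')).
Proof.
move=> dAB; rewrite [theta _](_ : _ = cov_minor (central x) A A' B B').
  apply: cov_minor_central => //.
  - exact: ideal_gen0.
  - exact: ideal_genD.
  - exact: ideal_genM.
  move=> A0 A0' B0 B0' sA sA' sB sB'; apply: cov_minor_coord.
  by apply: disjointW dAB; apply: setUSS.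
by rewrite /cov_minor /cov !(rmorphB, rmorphM) /= !theta_big_coord.
Qed.

Lemma evalp_theta (z : {set 'I_n} -> F) g : z set0 = 1 ->
  evalp (theta g) (fun B : nonempty_subset n => z (val B)) =
  evalp g (fun B : nonempty_subset n =>
    if (1 < #|val B|)%N then central z (val B) else z (val B)).
Proof.
move=> z0; rewrite /evalp comp_mpoly_meval; apply: meval_eq => k.
rewrite tnth_mktuple /=.
have ez A : (x A).@[fun k => z (val (enum_val k))] = z A by apply: evalp_coord.
case: ifP => _; last by rewrite ez.
rewrite /central raddf_sum; apply: eq_bigr => B _; rewrite /= mevalM ez.
rewrite /shift_coef rmorph_prod; congr (_ * _).
by apply: eq_bigr => i _; rewrite /= mevalN ez.
Qed.

End Coordinates.

(** * Straightening modulo the minors *)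

Section Straightening.
Variables (F : fieldType) (n : nat).
Local Notation N := #|{: nonempty_subset n}|.
Local Notation P := {mpoly F[N]}.
Local Notation x := (@Defs.coord F n).
Local Notation J := (ideal_gen (@flattening_minor3 F n)).
Local Notation theta := (comp_mpoly (central_tuple F n)).
Local Notation y := (@big_coord F n).
Local Notation mono := 'X_{1..N}.
Implicit Types (A B I : {set 'I_n}) (s t : seq {set 'I_n}) (f g h : P) (m : mono).
Implicit Types (c : bool * 'I_n -> nat) (L : nat) (j : bool * 'I_n).

Definition weight (w : {set 'I_n} -> nat) m :=
  (\sum_(k < N) m k * w (val (enum_val k)))%N.

Lemma weightD w m m' : weight w (m + m')%MM = (weight w m + weight w m')%N.
Proof.
by rewrite -big_split; apply: eq_bigr => k _; rewrite mnmDE mulnDl.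
Qed.

Lemma weight0 w : weight w 0%MM = 0%N.
Proof. by apply: big1 => k _; rewrite mnm0E. Qed.

Lemma weightU w (B : nonempty_subset n) : weight w U_(enum_rank B)%MM = w (val B).
Proof.
rewrite /weight (bigD1 (enum_rank B)) //= mnm1E eqxx mul1n enum_rankK.
rewrite big1 ?addn0 // => k neqk; rewrite mnm1E eq_sym (negbTE neqk) //.
Qed.

Definition degree := weight (fun A => (1 < #|A|)%N).

(** The multidegree separates occurrences of [i] in sets of size at least 2, index [(true, i)], from
    those in singletons, index [(false, i)]. On a secant point these are the exponents of d_i and of
    the mean. *)
Definition multiplicity j := weight (fun A => (j.1 == (1 < #|A|)%N) && (j.2 \in A)).

(* Spans the monomials of multidegree c with at least L factors x_A, 1 < #|A|. *)
Definition deep c L g :=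
  forall m, m \in msupp g -> multiplicity^~ m =1 c /\ (L <= degree m)%N.

Lemma deep0 c L : deep c L 0.
Proof. by move=> m; rewrite msupp0. Qed.

Lemma deepD c L g h : deep c L g -> deep c L h -> deep c L (g + h).
Proof.
by move=> Dg Dh m /msuppD_le; rewrite mem_cat => /orP[/Dg|/Dh].
Qed.

Lemma deepN c L g : deep c L g -> deep c L (- g).
Proof. by move=> Dg m; rewrite (perm_mem (msuppN g)) => /Dg. Qed.

Lemma deepB c L g h : deep c L g -> deep c L h -> deep c L (g - h).
Proof. by move=> Dg Dh; apply/deepD/deepN. Qed.

Lemma deepM c c' L L' g h : deep c L g -> deep c' L' h ->
  deep (fun j => c j + c' j)%N (L + L') (g * h).
Proof.
move=> Dg Dh m /msuppM_le /allpairsP[[m1 m2] [/= /Dg[c1 L1] /Dh[c2 L2] ->]].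
split; first by move=> j; rewrite /multiplicity weightD -/(multiplicity j _) c1 -c2.
by rewrite /degree weightD leq_add.
Qed.

Lemma deepX m : deep (multiplicity^~ m) (degree m) 'X_[m].
Proof. by move=> m'; rewrite msuppX inE => /eqP ->. Qed.

Lemma deep_eq c c' L g : c =1 c' -> deep c L g -> deep c' L g.
Proof. by move=> cc' Dg m /Dg[mc Lm]; split=> // j; rewrite mc. Qed.

Lemma deep_leq c L L' g : (L' <= L)%N -> deep c L g -> deep c L' g.
Proof. by move=> LL Dg m /Dg[mc Lm]; split=> //; apply: leq_trans Lm. Qed.

Definition profile s j := if j.1 then incidence s j.2 else 0%N.

Lemma deep_profileM s t L L' g h : deep (profile s) L g -> deep (profile t) L' h ->
  deep (profile (s ++ t)) (L + L') (g * h).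
Proof.
move=> Dg Dh; apply: deep_eq (deepM Dg Dh) => j.
by rewrite /profile /incidence count_cat; case: ifP.
Qed.

Lemma deep_big_coord A : A != set0 -> deep (profile [:: A]) 1 (y A).
Proof.
move=> A0; rewrite /big_coord; case: ifP => A1; last first.
  by rewrite (negbTE A0); apply: deep0.
rewrite -[A]/(val (exist _ A A0 : nonempty_subset n)) coord_val => m.
rewrite msuppX inE => /eqP ->; split; last by rewrite /degree weightU /= A1.
move=> [b i]; rewrite /multiplicity weightU /= A1 /profile /incidence /= addn0.
by case: b.
Qed.

Lemma incidence_setU A B s : [disjoint A & B] ->
  incidence (A :|: B :: s) =1 incidence [:: A, B & s].
Proof.
move=> dAB i; rewrite /incidence /= inE addnA.
by case: (boolP (i \in A)) => // iA; rewrite (disjointFr dAB iA).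
Qed.

Lemma eq_profile s t : incidence s =1 incidence t -> profile s =1 profile t.
Proof. by move=> st [[] i]; rewrite /profile /= ?st. Qed.

(** The correction [y A * y B] has the multidegree of [y (A :|: B)], as [A] and [B] are disjoint,
    but one more factor. *)
Lemma deep_cov A B : A != set0 -> B != set0 -> [disjoint A & B] ->
  deep (profile [:: A :|: B]) 2 (cov y A B - y (A :|: B)).
Proof.
move=> A0 B0 dAB; rewrite /cov [X in deep _ _ X](_ : _ = - (y A * y B)); last by ring.
apply: deepN.
apply: deep_eq (deep_profileM (deep_big_coord A0) (deep_big_coord B0)).
by apply: eq_profile => i; rewrite incidence_setU.
Qed.

Lemma deep_cov1 A B : A != set0 -> B != set0 -> [disjoint A & B] ->
  deep (profile [:: A :|: B]) 1 (cov y A B).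
Proof.
move=> A0 B0 dAB; rewrite -(subrK (y (A :|: B)) (cov _ _ _)).
apply: deepD; first by apply: deep_leq (deep_cov A0 B0 dAB).
by apply: deep_big_coord; rewrite setU_eq0 negb_and A0.
Qed.

Lemma deep_cov_cov A B A' B' :
    [disjoint A & B] -> [disjoint A' & B'] ->
    A != set0 -> B != set0 -> A' != set0 -> B' != set0 ->
  deep (profile [:: A :|: B; A' :|: B']) 3
    (y (A :|: B) * y (A' :|: B') - cov y A B * cov y A' B').
Proof.
move=> dAB dAB' A0 B0 A'0 B'0.
rewrite [X in deep _ _ X](_ : _ =
  - ((cov y A B - y (A :|: B)) * cov y A' B' +
     y (A :|: B) * (cov y A' B' - y (A' :|: B')))); last by ring.
apply/deepN/deepD.
  exact: deep_profileM (deep_cov A0 B0 dAB) (deep_cov1 A'0 B'0 dAB').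
apply: (@deep_profileM [:: _] [:: _] 1 2) _ (deep_cov A'0 B'0 dAB').
by apply: deep_big_coord; rewrite setU_eq0 negb_and A0.
Qed.

Definition prod_coord s : P := \prod_(A <- s) y A.

Lemma deep_prod_coord s : all (@plural _) s ->
  deep (profile s) (size s) (prod_coord s).
Proof.
elim: s => [_|A s IH /= /andP[A1 s1]].
  rewrite /prod_coord big_nil => m; rewrite msupp1 inE => /eqP ->.
  by split=> // -[b i]; rewrite /multiplicity weight0 /profile /incidence; case: b.
rewrite /prod_coord big_cons -[(size s).+1]add1n -cat1s.
apply: deep_profileM (IH s1); apply: deep_big_coord.
by rewrite -card_gt0; apply: ltnW.
Qed.

(** The relation to which [connectivity] is applied: congruence modulo the minors, up to terms of
    the same multidegree with more factors. *)
Definition straightens s t := [/\ size s = size t, incidence s =1 incidence t &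
  exists2 g, J (theta g) &
    deep (profile s) (size s).+1 (prod_coord s - prod_coord t - g)].

Lemma straightens_trans s t u :
  straightens s t -> straightens t u -> straightens s u.
Proof.
move=> [st inc [g Jg Dg]] [tu inc' [h Jh Dh]]; split; first by rewrite st.
  by move=> i; rewrite inc.
exists (g + h); first by rewrite rmorphD; apply: ideal_genD.
rewrite [X in deep _ _ X](_ : _ =
  (prod_coord s - prod_coord t - g) + (prod_coord t - prod_coord u - h)); last by ring.
apply: deepD => //; rewrite st; apply: deep_eq Dh.
by apply: eq_profile => i; rewrite inc.
Qed.

Lemma straightens_perm s t : perm_eq s t -> straightens s t.
Proof.
move=> pst; split; first exact: perm_size.
  by move=> i; apply/permP.
exists 0; first by rewrite rmorph0; apply: ideal_gen0.
rewrite /prod_coord (perm_big _ pst) subrr subr0; exact: deep0.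
Qed.

Lemma straightens_cat s t u : all (@plural _) u ->
  straightens s t -> straightens (s ++ u) (t ++ u).
Proof.
move=> u1 [st inc [g Jg Dg]]; split; first by rewrite !size_cat st.
  by move=> i; rewrite /incidence !count_cat -!/(incidence _ i) inc.
exists (prod_coord u * g); first by rewrite rmorphM; apply: ideal_genM.
rewrite [X in deep _ _ X](_ : _ =
  (prod_coord s - prod_coord t - g) * prod_coord u); last first.
  by rewrite /prod_coord !big_cat /=; ring.
rewrite size_cat -addSn; apply: deep_profileM => //; exact: deep_prod_coord.
Qed.

Lemma straightens_cons A s t : plural A ->
  straightens s t -> straightens (A :: s) (A :: t).
Proof.
move=> A1 /(@straightens_cat _ _ [:: A]); rewrite /= A1 => /(_ isT) E.
apply: straightens_trans (straightens_trans E _); apply: straightens_perm.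
  by rewrite -cat1s perm_catC.
by rewrite -cat1s perm_catC.
Qed.

(** The witness is [cov_minor y A A' B B']: its quadratic part is the exchange binomial, and all
    corrections have at least three factors. *)
Lemma straightens_exchange A B A' B' s : all (@plural _) s ->
    [disjoint A :|: A' & B :|: B'] ->
    A != set0 -> B != set0 -> A' != set0 -> B' != set0 ->
  straightens [:: A :|: B, A' :|: B' & s] [:: A :|: B', A' :|: B & s].
Proof.
move=> s1 dAB A0 B0 A'0 B'0.
have dis (C D : {set _}) : C \subset A :|: A' -> D \subset B :|: B' -> [disjoint C & D].
  by move=> sC sD; apply: (disjointW sC sD dAB).
have [[sA sA'] [sB sB']] : (A \subset A :|: A' /\ A' \subset A :|: A') /\
    (B \subset B :|: B' /\ B' \subset B :|: B').
  by split; split; rewrite ?subsetUl ?subsetUr.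
have inc : incidence [:: A :|: B; A' :|: B'] =1 incidence [:: A :|: B'; A' :|: B].
  move=> i; rewrite !incidence_setU ?dis // /incidence /= !inE.
  have := @disjointFr _ _ _ i (dis _ _ sA' sB).
  have := @disjointFr _ _ _ i (dis _ _ sA' sB').
  case: (i \in A') => [|_ _]; first by move=> -> // -> //.
  by rewrite /= !addn0 (addnC (nat_of_bool (i \in B))).
apply: (@straightens_cat [:: _; _] [:: _; _]) => //; split=> //.
exists (cov_minor y A A' B B'); first exact: cov_minor_big_coord.
rewrite [X in deep _ _ X](_ : _ =
  (y (A :|: B) * y (A' :|: B') - cov y A B * cov y A' B') -
  (y (A :|: B') * y (A' :|: B) - cov y A B' * cov y A' B)); last first.
  by rewrite /prod_coord !big_cons !big_nil /cov_minor; ring.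
apply: deepB; first by apply: deep_cov_cov => //; apply: dis.
by apply: deep_eq (eq_profile (fsym inc)) _; apply: deep_cov_cov => //; apply: dis.
Qed.

(** The exchange of the blocks {i} and {i'}. *)
Lemma straightens_swap I I' s i i' : all (@plural _) s ->
  i \in I -> i \notin I' -> i' \in I' -> i' \notin I ->
  (1 < #|I|)%N -> (1 < #|I'|)%N ->
  straightens [:: I, I' & s] [:: i' |: (I :\ i), i |: (I' :\ i') & s].
Proof.
move=> s1 iI iI' i'I' i'I I1 I'1.
have E := @straightens_exchange (I :\ i) [set i] (I' :\ i') [set i'] s s1.
have e1 : I :\ i :|: [set i] = I by rewrite setUC setD1K.
have e2 : I' :\ i' :|: [set i'] = I' by rewrite setUC setD1K.
rewrite e1 e2 in E; rewrite (setUC [set i']) (setUC [set i]); apply: E.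
- rewrite disjoints_subset; apply/subsetP => z; rewrite !inE negb_or.
  by case: eqVneq => [->|_]; case: eqVneq => [->|_] //=; rewrite ?(negbTE iI') ?(negbTE i'I).
- by rewrite -card_gt0; move: I1; rewrite (cardsD1 i I) iI.
- by rewrite -card_gt0 cards1.
- by rewrite -card_gt0; move: I'1; rewrite (cardsD1 i' I') i'I'.
- by rewrite -card_gt0 cards1.
Qed.

(** If [I] and [I'] share an element z, exchange {i, z} against {z}. If they are disjoint, exchange
    {i, i1} against {i2} with i1 in [I] and i2 in [I'], then swap i1 and i2 back. Three elements in
    [I] keep its remaining block nonempty. *)
Lemma straightens_transfer I I' s i : all (@plural _) s ->
  i \in I -> i \notin I' -> (2 < #|I|)%N -> (1 < #|I'|)%N ->
  straightens [:: I, I' & s] [:: I :\ i, i |: I' & s].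
Proof.
move=> s1 iI iI' I2 I'1.
have [/eqP|[z]] := set_0Vmem (I :&: I').
  rewrite setI_eq0 => dII'.
  have [i1] : exists i1, i1 \in I :\ i.
    by apply/set0Pn; rewrite -card_gt0; move: I2; rewrite (cardsD1 i I) iI; apply: ltnW.
  rewrite !inE => /andP[i1i i1I]; have i1I' := disjointFr dII' i1I.
  have [i2 i2I'] : exists i2, i2 \in I' by apply/set0Pn; rewrite -card_gt0 ltnW.
  have i2I := disjointFl dII' i2I'.
  have neq i3 : i3 \in I -> i2 != i3 by apply: contraTneq => <-; rewrite i2I.
  pose A := I :\ i :\ i1; pose A' := I' :\ i2.
  have A0 : A != set0.
    by rewrite -card_gt0; move: I2; rewrite (cardsD1 i I) iI (cardsD1 i1) !inE i1i i1I.
  have A'0 : A' != set0.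
    by rewrite -card_gt0; move: I'1; rewrite (cardsD1 i2 I') i2I'.
  have E1 : straightens [:: A :|: [set i; i1], A' :|: [set i2] & s]
                        [:: A :|: [set i2], A' :|: [set i; i1] & s].
    apply: straightens_exchange => //.
    - rewrite disjoints_subset; apply/subsetP => z; rewrite !inE.
      case: (eqVneq z i) => [->|_]; first by rewrite (negbTE iI') andbF andbF.
      case: (eqVneq z i1) => [->|_]; first by rewrite i1I' andbF.
      by case: (eqVneq z i2) => [->|_] //; rewrite i2I.
    - by rewrite -card_gt0 cards2.
    - by rewrite -card_gt0 cards1.
  have i2A' : i2 \notin A' :|: [set i; i1] by rewrite !inE eqxx !(negbTE (neq _ _)).
  have i1A : i1 \notin A :|: [set i2].
    by rewrite !inE eqxx /= eq_sym (negbTE (neq _ i1I)).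
  have E2 : straightens [:: A :|: [set i2], A' :|: [set i; i1] & s]
    [:: i1 |: ((A :|: [set i2]) :\ i2), i2 |: ((A' :|: [set i; i1]) :\ i1) & s].
    apply: straightens_swap => //; rewrite ?inE ?eqxx ?orbT //.
      by rewrite setUC cardsU1 !inE i2I !andbF ltnS card_gt0.
    by apply: leq_trans (subset_leq_card (subsetUr _ _)); rewrite cards2 eq_sym i1i.
  have -> : I' = A' :|: [set i2] by rewrite setUC setD1K.
  have {1}-> : I = A :|: [set i; i1].
    by rewrite [[set i; i1]]setUC setUA [A :|: _]setUC setD1K ?inE ?i1i // setUC setD1K.
  have -> : I :\ i = i1 |: ((A :|: [set i2]) :\ i2).
    rewrite [A :|: _]setUC setU1K ?setD1K ?inE ?i1i //.
    by rewrite i2I !andbF.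
  have -> : i |: (A' :|: [set i2]) = i2 |: ((A' :|: [set i; i1]) :\ i1).
    rewrite [[set i; i1]]setUC [A' :|: (_ :|: _)]setUCA setU1K.
      by rewrite setUA setUC [i |: A']setUC.
    by rewrite !inE i1I' andbF (negbTE i1i).
  exact: straightens_trans E1 E2.
rewrite inE => /andP[zI zI'].
have neqzi : z != i by apply: contraNneq iI' => <-.
have E : straightens [:: (I :\ i :\ z) :|: [set i; z], (I' :\ z) :|: [set z] & s]
                     [:: (I :\ i :\ z) :|: [set z], (I' :\ z) :|: [set i; z] & s].
  apply: straightens_exchange => //.
  - rewrite disjoints_subset; apply/subsetP => u; rewrite !inE.
    case: (eqVneq u i) => [->|_]; first by rewrite (negbTE iI') !andbF.
    by case: (eqVneq u z).
  - rewrite -card_gt0; move: I2.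
    by rewrite (cardsD1 i I) iI (cardsD1 z) !inE neqzi zI.
  - by rewrite -card_gt0 cards2.
  - by rewrite -card_gt0; move: I'1; rewrite (cardsD1 z I') zI'.
  - by rewrite -card_gt0 cards1.
have e1 : (I :\ i :\ z) :|: [set z] = I :\ i by rewrite setUC setD1K // !inE neqzi.
have e2 : (I' :\ z) :|: [set z] = I' by rewrite setUC setD1K.
have e3 : (I :\ i :\ z) :|: [set i; z] = I.
  by rewrite [[set i; z]]setUC setUA e1 setUC setD1K.
have e4 : (I' :\ z) :|: [set i; z] = i |: I'.
  by rewrite [[set i; z]]setUC setUA e2 setUC.
by rewrite e1 e2 e3 e4 in E.
Qed.

Lemma straightens_all s t : all (@plural _) s -> all (@plural _) t ->
  size s = size t -> incidence s =1 incidence t -> straightens s t.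
Proof.
apply: connectivity.
- exact: straightens_trans.
- exact: straightens_perm.
- exact: straightens_cons.
- by move=> ? ? [].
- by move=> ? ? [].
- exact: straightens_transfer.
- exact: straightens_swap.
Qed.

Definition plural_list m : seq {set 'I_n} :=
  flatten [seq nseq (m k) (val (enum_val k)) |
            k : 'I_N <- index_enum 'I_N & (1 < #|val (enum_val k)|)%N].

Definition singles m : mono :=
  [multinom if (1 < #|val (enum_val k)|)%N then 0%N else m k | k < N].

Lemma sum_plural_list w m : (\sum_(A <- plural_list m) w A)%N =
  weight (fun A => (1 < #|A|)%N * w A)%N m.
Proof.
rewrite /plural_list big_flatten big_map big_filter big_mkcond.
apply: eq_bigr => k _; rewrite big_nseq iter_addn_0 mulnC.
by case: ifP; rewrite ?mul1n ?mul0n ?muln0.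
Qed.

Lemma all_plural_list m : all (@plural _) (plural_list m).
Proof.
apply/allP => A /flattenP[_ /mapP[k + ->]]; rewrite mem_filter => /andP[k1 _].
by move/nseqP => [->].
Qed.

Lemma size_plural_list m : size (plural_list m) = degree m.
Proof.
rewrite -sum1_size sum_plural_list; apply: eq_bigr => k _.
by rewrite muln1.
Qed.

Lemma incidence_plural_list m i :
  incidence (plural_list m) i = multiplicity (true, i) m.
Proof.
rewrite /incidence -sum1_count big_mkcond sum_plural_list.
by apply: eq_bigr => k _ /=; case: ltnP => _; case: (i \in _).
Qed.

Lemma monomial_split m :
  'X_[m] = 'X_[singles m] * prod_coord (plural_list m) :> P.
Proof.
rewrite /prod_coord /plural_list big_flatten big_map big_filter big_mkcond.
rewrite !mpolyXE_id -big_split; apply: eq_bigr => k _ /=.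
rewrite mnmE big_nseq iter_mulr_1; case: ifP => k1; last by rewrite mulr1.
by rewrite mul1r /big_coord k1 coord_val enum_valK.
Qed.

Lemma multiplicity_singles m j : multiplicity j m =
  (multiplicity j (singles m) + profile (plural_list m) j)%N.
Proof.
case: j => [[] i]; rewrite /profile /= ?incidence_plural_list ?addn0.
  rewrite [X in (X + _)%N]big1 // => k _; rewrite mnmE /=.
  by case: ifP => //; rewrite muln0.
apply: eq_bigr => k _; rewrite mnmE /=.
by case: ifP => //; rewrite muln0.
Qed.

Lemma multiplicity_single m (B : nonempty_subset n) i : val B = [set i] ->
  multiplicity (false, i) m = m (enum_rank B).
Proof.
move=> Bi; rewrite /multiplicity /weight (bigD1 (enum_rank B)) //= enum_rankK.
rewrite Bi cards1 set11 muln1 big1 ?addn0 // => k neqk.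
case: ltnP => /= k1; rewrite ?muln0 //.
case: (boolP (i \in val (enum_val k))) => /= ik; rewrite ?muln0 //.
case/eqP: neqk.
apply: (can_inj enum_valK); rewrite enum_rankK; apply: val_inj.
by rewrite Bi; apply/esym/eqP; rewrite eqEcard sub1set ik cards1.
Qed.

(** The component [(false, i)] of the multidegree is the exponent of the variable of {i} itself. *)
Lemma eq_singles m m' : multiplicity^~ m =1 multiplicity^~ m' ->
  singles m = singles m'.
Proof.
move=> mm'; apply/mnmP => k; rewrite !mnmE; case: ltnP => // k1.
have /cards1P[i ki] : #|val (enum_val k)| == 1%N.
  by rewrite eqn_leq k1 card_gt0; apply: (valP (enum_val k)).
by have := mm' (false, i); rewrite !(multiplicity_single _ ki) enum_valK.
Qed.

(** The singleton parts coincide, so it suffices to straighten the remaining parts and multiply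
    back. *)
Lemma monomial_straighten m m' : multiplicity^~ m =1 multiplicity^~ m' ->
    degree m = degree m' ->
  exists2 g, J (theta g) &
    deep (multiplicity^~ m) (degree m).+1 ('X_[m] - 'X_[m'] - g).
Proof.
move=> mm' dd'.
have [_ _ [g Jg Dg]] : straightens (plural_list m) (plural_list m').
  apply: straightens_all; rewrite ?all_plural_list ?size_plural_list //.
  by move=> i; rewrite !incidence_plural_list mm'.
exists ('X_[singles m] * g); first by rewrite rmorphM; apply: ideal_genM.
rewrite (monomial_split m') -(eq_singles mm') (monomial_split m).
rewrite [X in deep _ _ X](_ : _ = 'X_[singles m] *
  (prod_coord (plural_list m) - prod_coord (plural_list m') - g)); last by ring.
apply: deep_leq (deep_eq _ (deepM (@deepX (singles m)) Dg)).
  by rewrite size_plural_list leq_addl.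
by move=> j; rewrite (multiplicity_singles m).
Qed.

End Straightening.

(** * Points of the secant variety *)

Section Secants.
Variables (F : fieldType) (n : nat).
Implicit Types (A B C : {set 'I_n}) (a : 'I_n -> F * F).

Lemma segre_map_prod a C :
  segre_map a C = \prod_i (if i \in C then (a i).1 else (a i).2).
Proof.
rewrite ffunE [RHS](bigID (mem C)) /=; congr (_ * _).
  by apply: eq_bigr => i ->.
by apply: eq_bigr => i /negbTE ->.
Qed.

(** A flattening of a Segre point is a column times a row, hence of rank at most one. *)
Lemma segre_map_setU a (I1 I2 A B : {set 'I_n}) :
    I1 :|: I2 = setT -> I1 :&: I2 = set0 -> A \subset I1 -> B \subset I2 ->
  segre_map a (A :|: B) = (\prod_(i in I1) (if i \in A then (a i).1 else (a i).2)) *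
                          (\prod_(i in I2) (if i \in B then (a i).1 else (a i).2)).
Proof.
move=> I12 dI12 /subsetP sA /subsetP sB.
have I2E i : (i \in I2) = (i \notin I1).
  move/setP/(_ i): I12; move/setP/(_ i): dI12; rewrite !inE.
  by case: (i \in I1) (i \in I2) => [] [].
rewrite segre_map_prod (bigID (mem I1)) /=; congr (_ * _).
  apply: eq_bigr => i iI1; rewrite inE; case: (boolP (i \in B)) => [/sB|_].
    by rewrite I2E iI1.
  by rewrite orbF.
apply: eq_big => i; first by rewrite I2E.
move=> iI1; rewrite inE; case: (boolP (i \in A)) => [/sA|_] //.
by rewrite (negbTE iI1).
Qed.

Lemma evalp_det_var (z : {set 'I_n} -> F) (I1 I2 : {set 'I_n})
    (r : 'I_3 -> 'I_#|powerset I1|) (c : 'I_3 -> 'I_#|powerset I2|) :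
  evalp (\det (mxsub r c (flattening (fun A : {set 'I_n} => var F A) I1 I2))) z =
  \det (mxsub r c (flattening z I1 I2)).
Proof.
rewrite /evalp -det_map_mx; congr (\det _); apply/matrixP => i j.
by rewrite !mxE /var /= mevalXU enum_rankK.
Qed.

(** On a secant line the flattening is a sum of two matrices of rank at most one. *)
Lemma det_secant (z : {ffun {set 'I_n} -> F}) (I1 I2 : {set 'I_n})
    (r : 'I_3 -> 'I_#|powerset I1|) (c : 'I_3 -> 'I_#|powerset I2|) :
    I1 :|: I2 = setT -> I1 :&: I2 = set0 ->
    union_of_secant_lines (@segre F n) z ->
  \det (mxsub r c (flattening z I1 I2)) = 0.
Proof.
move=> I12 dI12 [_ [p [q [[a _ [cp _ pE]] [b _ [cq _ qE]] _ [s [t zE]]]]]].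
rewrite det_mx33 !mxE !zE !pE !qE.
have sr i : enum_val (r i) \subset I1 by rewrite -powersetE enum_valP.
have sc i : enum_val (c i) \subset I2 by rewrite -powersetE enum_valP.
rewrite !(segre_map_setU _ I12 dI12 (sr _) (sc _)).
by ring.
Qed.

Lemma flattening_minor3_vanishing g :
  flattening_minor3 g -> vanishing_ideal (@affine_secant F n) g.
Proof.
move=> [I1 [I2 [_ _ I12 dI12 [r [c [_ _ ->]]]]]] x [[_ xV] x0].
(* The closure is tested on homogeneous polynomials, so the minor is taken with the coordinate of
   [set0] as a variable: a cubic form that restricts to the given minor on the chart. *)
pose f := \det (mxsub r c (flattening (fun A : {set 'I_n} => var F A) I1 I2)).
have fh : f \is 3.-homog.
  have vh A : var F A \is 1.-homog by rewrite /var dhomogX /= mdeg1.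
  have h2 A B C D : var F A * var F B - var F C * var F D \is 2.-homog.
    by apply: rpredB; apply: (@dhomogM _ _ _ 1 _ 1).
  rewrite /f det_mx33 !mxE.
  by apply: rpredD; [apply: rpredB|]; apply: (@dhomogM _ _ _ 1 _ 2).
transitivity (evalp f x); last first.
  apply: xV fh _ => y yS; rewrite /f evalp_det_var; exact: det_secant.
rewrite /f evalp_det_var /evalp -det_map_mx; congr (\det _).
by apply/matrixP => i j; rewrite !mxE -(evalp_coord _ x0).
Qed.

Lemma ideal_gen_vanishing f : ideal_gen (@flattening_minor3 F n) f ->
  vanishing_ideal (@affine_secant F n) f.
Proof.
move=> [s sS ->] x xV; rewrite /evalp raddf_sum big_seq big1 // => hg /sS.
by move/flattening_minor3_vanishing/(_ x xV); rewrite /evalp /= mevalM => ->; rewrite mulr0.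
Qed.

(* The point of the secant with weights u and 1 - u on two points of the
   Segre variety whose difference is d and whose weighted mean is mu. *)
Definition secant_point (mu d : 'I_n -> F) (u : F) : {ffun {set 'I_n} -> F} :=
  [ffun A : {set 'I_n} => u * \prod_(i in A) (mu i + (1 - u) * d i) +
                          (1 - u) * \prod_(i in A) (mu i - u * d i)].

Lemma secant_point0 mu d u : secant_point mu d u set0 = 1.
Proof. by rewrite ffunE !big_set0; ring. Qed.

Lemma secant_point1 mu d u i : secant_point mu d u [set i] = mu i.
Proof. by rewrite ffunE !big_set1; ring. Qed.

Lemma segre_map_segre (v : 'I_n -> F) : segre (segre_map (fun i => (v i, 1))).
Proof.
exists (fun i => (v i, 1)); last by exists 1; rewrite ?oner_neq0 // => A; rewrite mul1r.
by move=> i; rewrite xpair_eqE oner_eq0 andbF.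
Qed.

Lemma segre_map_affine (v : 'I_n -> F) A :
  segre_map (fun i => (v i, 1)) A = \prod_(i in A) v i.
Proof. by rewrite ffunE /= [X in _ * X]big1 ?mulr1. Qed.

(** A nonzero [d i] makes the two Segre points distinct, so they span a line. *)
Lemma affine_secant_point mu d u i : d i != 0 ->
  affine_secant (secant_point mu d u).
Proof.
move=> di; split; last exact: secant_point0.
have z0 : secant_point mu d u != 0.
  apply/eqP => /ffunP/(_ set0); rewrite secant_point0 ffunE => /eqP.
  by rewrite oner_eq0.
split=> // e f _; apply; split=> //.
exists (segre_map (fun i => (mu i + (1 - u) * d i, 1))).
exists (segre_map (fun i => (mu i - u * d i, 1))).
split; try exact: segre_map_segre.
  move=> [c _ E]; have := E set0; have := E [set i].
  rewrite !segre_map_affine !big_set0 !big_set1 mulr1 => + c1; rewrite -c1 mul1r.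
  move=> /eqP; rewrite -subr_eq0 [X in X == 0](_ : _ = - d i); last by ring.
  by rewrite oppr_eq0 (negbTE di).
by exists u, (1 - u) => A; rewrite !segre_map_affine ffunE.
Qed.

Lemma sum_subset_prod (R : comNzRingType) (p v : 'I_n -> R) A :
  \sum_(B : {set 'I_n} | B \subset A) (\prod_(i in B) p i) * (\prod_(i in A :\: B) v i) =
  \prod_(i in A) (p i + v i).
Proof.
(* Factors 0 + 1 outside [A] kill every subset that is not contained in [A]. *)
transitivity (\prod_i ((if i \in A then p i else 0) + (if i \in A then v i else 1))).
  rewrite bigA_distr [RHS](bigID (fun B : {set 'I_n} => B \subset A)) /=.
  rewrite [X in _ = _ + X]big1 ?addr0 => [|B /subsetPn[i iB iA]]; last first.
    by rewrite (bigD1 i) //= iB (negbTE iA) mul0r.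
  apply: eq_bigr => B sBA; rewrite [in LHS]big_mkcond [X in _ * X]big_mkcond -big_split.
  apply: eq_bigr => i _ /=; rewrite inE.
  have := subsetP sBA i; case: (i \in B) => [->//|_] /=; first by rewrite mulr1.
  by rewrite mul1r.
rewrite [RHS]big_mkcond; apply: eq_bigr => i _; case: ifP => // _.
by rewrite add0r.
Qed.

(** These are the central moments of a two-point distribution: the deviations from the mean are (1 -
    u) d with weight u and - u d with weight 1 - u. *)
Lemma central_secant_point mu d u A : central (secant_point mu d u) A =
  (u * (1 - u) ^+ #|A| + (1 - u) * (- u) ^+ #|A|) * \prod_(i in A) d i.
Proof.
rewrite /central /shift_coef.
transitivity (u * \prod_(i in A) (mu i + (1 - u) * d i - mu i) +
              (1 - u) * \prod_(i in A) (mu i - u * d i - mu i)).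
  rewrite -!sum_subset_prod !mulr_sumr -big_split; apply: eq_bigr => B _ /=.
  under eq_bigr => i _ do rewrite secant_point1.
  by rewrite ffunE; ring.
have e c : \prod_(i in A) (mu i + c * d i - mu i) = c ^+ #|A| * \prod_(i in A) d i.
  rewrite -prodr_const -big_split; apply: eq_bigr => i _ /=; ring.
rewrite e; under [X in _ + _ * X]eq_bigr => i _ do rewrite -mulNr.
by rewrite e; ring.
Qed.

End Secants.

(** In characteristic 0 the nonzero points 1, ..., [size p] are distinct and outnumber the roots of
    a nonzero [p]. *)
Lemma poly_vanishing_nonzero (F : numFieldType) (p : {poly F}) :
  (forall u, u != 0 -> p.[u] = 0) -> p = 0.
Proof.
move=> p0; apply/eqP/negPn/negP => neqp0.
have := @max_poly_roots _ p [seq i.+1%:R | i <- iota 0 (size p)] neqp0.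
rewrite size_map size_iota ltnn => H; suff : false by []; apply: H.
  by apply/allP => _ /mapP[i _ ->]; rewrite /root p0 // pnatr_eq0.
rewrite map_inj_uniq ?iota_uniq // => i j /eqP.
by rewrite eqr_nat => /eqP [].
Qed.

(** One variable at a time: with the others fixed, the sum is a polynomial vanishing at all nonzero
    points, so each of its coefficients is 0. Testing only nonzero coordinates keeps the two points
    of the secant distinct. *)
Lemma multigraded_component_sum (F : numFieldType) (I : finType) (T : Type)
    (s : seq T) (a : T -> F) (e : T -> I -> nat) :
    (forall v : I -> F, (forall i, v i != 0) ->
      \sum_(x <- s) a x * \prod_i v i ^+ e x i = 0) ->
  forall c : I -> nat, \sum_(x <- s | [forall i, e x i == c i]) a x = 0.
Proof.
move=> H c.
suff {H} gen (r : seq I) s' : uniq r -> (forall v : I -> F, (forall i, v i != 0) ->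
      \sum_(x <- s') a x * \prod_(i <- r) v i ^+ e x i = 0) ->
    \sum_(x <- s' | all (fun i => e x i == c i) r) a x = 0.
  rewrite -[RHS](gen (index_enum I) s (index_enum_uniq I) H); apply: eq_bigl => x.
  by apply/forallP/allP => [h i _|h i]; [exact: h|apply: h; rewrite mem_index_enum].
elim: r s' => [|i r IH] s' /=.
  move=> _ H; rewrite -[RHS](H (fun=> 1)) => [|_]; last exact: oner_neq0.
  by apply: eq_bigr => x _; rewrite big_nil mulr1.
case/andP=> ir ur H.
rewrite -[LHS]big_filter_cond; apply: IH => // v v0.
pose q : {poly F} := \sum_(x <- s') (a x * \prod_(j <- r) v j ^+ e x j) *: 'X^(e x i).
have q0 : q = 0.
  apply: poly_vanishing_nonzero => t t0.
  rewrite /q horner_sum -[RHS](H (fun j => if j == i then t else v j)); last first.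
    by move=> j; case: ifP.
  apply: eq_bigr => x _; rewrite big_cons eqxx hornerZ hornerXn -mulrA.
  rewrite [X in _ * X]mulrC; congr (_ * (_ * _)); apply: eq_big_seq => j jr.
  by case: eqP => // ji; rewrite -ji jr in ir.
have : q`_(c i) = 0 by rewrite q0 coef0.
rewrite /q coef_sum => qc; rewrite big_filter big_mkcond /= -[RHS]qc.
apply: eq_bigr => x _; rewrite coefZ coefXn eq_sym.
by case: eqP; rewrite ?mulr1 ?mulr0.
Qed.

Lemma prod_bool_pair (R : comNzRingType) (I : finType) (G : bool * I -> R) :
  \prod_j G j = (\prod_i G (true, i)) * (\prod_i G (false, i)).
Proof.
rewrite -(big_bool _ (fun b => \prod_i G (b, i))) pair_bigA.
by apply: eq_bigr => -[].
Qed.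

(** * Degeneration of the secant parametrization at u = 0 *)

Section Vanishing.
Variables (F : numFieldType) (n : nat).
Local Notation N := #|{: nonempty_subset n}|.
Local Notation P := {mpoly F[N]}.
Local Notation J := (ideal_gen (@flattening_minor3 F n)).
Local Notation theta := (comp_mpoly (central_tuple F n)).
Local Notation mono := 'X_{1..N}.
Implicit Types (A B : {set 'I_n}) (f g h : P) (m : mono).

(* For 1 < #|A|, u times its value at u is the coefficient of d^A in the central
   moment of a secant point. *)
Definition tail_poly A : {poly F} :=
  if (1 < #|A|)%N then (1 - 'X) ^+ #|A| + (1 - 'X) * (- 1) ^+ #|A| * 'X^(#|A|.-1)
  else 1.

Definition monomial_tail m : {poly F} :=
  \prod_(k < N) tail_poly (val (enum_val k)) ^+ m k.

(** For sets of size at least 2 the second term of [tail_poly] carries a positive power of ['X]. *)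
Lemma monomial_tail0 m : (monomial_tail m).[0] = 1.
Proof.
rewrite horner_prod big1 // => k _; rewrite horner_exp /tail_poly.
case: ifP => [A1|_]; last by rewrite hornerC expr1n.
rewrite !(hornerE, horner_exp, hornerXn) expr0n -subn1 subn_eq0 leqNgt A1.
by rewrite mulr0 addr0 subr0 !expr1n.
Qed.

Section Evaluation.
Variables (v : bool * 'I_n -> F) (u : F).
Local Notation z := (secant_point (fun i => v (false, i)) (fun i => v (true, i)) u).

Lemma central_coordinate A : A != set0 ->
  (if (1 < #|A|)%N then central z A else z A) =
  u ^+ (1 < #|A|)%N * (tail_poly A).[u] *
    \prod_j v j ^+ ((j.1 == (1 < #|A|)%N) && (j.2 \in A)).
Proof.
move=> A0.
rewrite prod_bool_pair /= /tail_poly; case: ltnP => A1.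
  rewrite [X in _ * (_ * X)]big1 ?mulr1 // central_secant_point [in LHS]big_mkcond /=.
  congr (_ * _); last by apply: eq_bigr => i _; case: (i \in A).
  rewrite !(hornerE, horner_exp, hornerXn) exprNn -[in u ^+ #|A|](prednK (ltnW A1)).
  by rewrite exprS; ring.
rewrite [X in _ * (X * _)]big1 // !mul1r hornerC mul1r.
have /cards1P[i ->] : #|A| == 1%N by rewrite eqn_leq A1 card_gt0.
rewrite secant_point1 (bigD1 i) //= set11 big1 ?mulr1 // => i' /negbTE neq.
by rewrite inE neq.
Qed.

Lemma evalp_monomial m :
  evalp 'X_[m] (fun B : nonempty_subset n =>
    if (1 < #|val B|)%N then central z (val B) else z (val B)) =
  u ^+ degree m * (monomial_tail m).[u] * \prod_j v j ^+ multiplicity j m.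
Proof.
rewrite /evalp mevalX.
under [LHS]eq_bigr => k _ do
  rewrite /= central_coordinate ?(valP (enum_val k)) // !exprMn -exprM -prodrXl.
rewrite !big_split /= /monomial_tail horner_prod; congr (_ * _ * _).
- by rewrite prodrXr; congr (_ ^+ _); apply: eq_bigr => k _; rewrite mulnC.
- by apply: eq_bigr => k _; rewrite horner_exp.
rewrite exchange_big; apply: eq_bigr => j _.
under eq_bigr => k _ do rewrite -exprM.
by rewrite prodrXr; congr (_ ^+ _); apply: eq_bigr => k _; rewrite mulnC.
Qed.

Lemma vanishing_evaluation g (i : 'I_n) : v (true, i) != 0 ->
  vanishing_ideal (@affine_secant F n) (theta g) ->
  \sum_(m <- msupp g) g@_m *
    (u ^+ degree m * (monomial_tail m).[u] * \prod_j v j ^+ multiplicity j m) = 0.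
Proof.
move=> vi0 gV; have zV : affine_secant z by apply: (@affine_secant_point _ _ _ _ u i).
move/(_ _ zV): gV.
rewrite evalp_theta ?secant_point0 // => g0; rewrite -[RHS]g0 [in RHS](mpolyE g).
rewrite /evalp raddf_sum; apply: eq_bigr => m _.
by rewrite /= mevalZ -evalp_monomial.
Qed.

End Evaluation.

Lemma lowest_class_sum g L c : (0 < n)%N ->
    vanishing_ideal (@affine_secant F n) (theta g) ->
    {in msupp g, forall m, (L <= degree m)%N} ->
  \sum_(m <- msupp g | (degree m == L) && [forall j, multiplicity j m == c j]) g@_m = 0.
Proof.
move=> n0 gV gL; rewrite -big_filter_cond.
apply: (@multigraded_component_sum _ _ _ _ _ (fun m j => multiplicity j m)) => v v0.
(* The value of [theta g] at the secant point, divided by [u ^+ L], as a polynomial in u. *)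
pose q : {poly F} := \sum_(m <- msupp g)
  (g@_m * \prod_j v j ^+ multiplicity j m) *: ('X^(degree m - L) * monomial_tail m).
have q0 : q = 0.
  apply: poly_vanishing_nonzero => u u0; apply: (mulfI (expf_neq0 L u0)).
  rewrite mulr0 -[RHS](vanishing_evaluation u (v0 (true, Ordinal n0)) gV).
  rewrite /q horner_sum mulr_sumr; apply: eq_big_seq => m /gL Lm.
  have -> : u ^+ degree m = u ^+ L * u ^+ (degree m - L) by rewrite -exprD subnKC.
  rewrite hornerZ hornerM hornerXn.
  move: (\prod_j _) (_.[u]) (u ^+ L) (u ^+ (degree m - L)) (g@_m).
  by move=> a b d e k; ring.
(* At 0 exactly the monomials of degree [L] survive, each with tail value 1. *)
have := congr1 (fun p : {poly F} => p.[0]) q0; rewrite horner0 => qz.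
rewrite big_filter big_mkcond /= -[RHS]qz /q horner_sum; apply: eq_big_seq => m /gL Lm.
rewrite hornerZ hornerM monomial_tail0 hornerXn expr0n mulr1 subn_eq0.
by rewrite eqn_leq Lm andbT; case: ifP; rewrite ?mulr1 ?mulr0.
Qed.

End Vanishing.

(** * Generation of the vanishing ideal *)

(** After grouping, each [w c] is multiplied by the coefficient sum of its class. *)
Lemma sum_by_class (F : fieldType) (V : lmodType F) (T C : eqType)
    (s : seq T) (a : T -> F) (cls : T -> C) (w : C -> V) :
    (forall c, \sum_(x <- s | cls x == c) a x = 0) ->
  \sum_(x <- s) a x *: w (cls x) = 0.
Proof.
move=> a0; pose cs := undup (map cls s).
transitivity (\sum_(x <- s) \sum_(c <- cs | cls x == c) a x *: w c).
  apply: eq_big_seq => x xs; rewrite -big_filter.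
  under eq_filter => c do rewrite eq_sym.
  rewrite filter_pred1_uniq ?undup_uniq ?big_seq1 //.
  by rewrite mem_undup map_f.
rewrite (exchange_big_dep xpredT) //= big1 // => c _.
by rewrite -scaler_suml a0 scale0r.
Qed.

Section Generation.
Variables (F : numFieldType) (n : nat).
Hypothesis n_gt0 : (0 < n)%N.
Local Notation N := #|{: nonempty_subset n}|.
Local Notation P := {mpoly F[N]}.
Local Notation J := (ideal_gen (@flattening_minor3 F n)).
Local Notation V := (@affine_secant F n).
Local Notation theta := (comp_mpoly (central_tuple F n)).
Local Notation mono := 'X_{1..N}.
Implicit Types (f g h : P) (m : mono).

Definition total_multiplicity m := (\sum_j multiplicity j m)%N.

(** The bound that stops the process: each factor of positive degree contains an element that is
    counted. *)
Lemma degree_leq_total m : (degree m <= total_multiplicity m)%N.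
Proof.
rewrite /total_multiplicity exchange_big; apply: leq_sum => k _ /=.
rewrite -big_distrr /= leq_mul2l; apply/orP; right.
case: ltnP => // A1.
have /card_gt0P[i iA] := ltnW A1.
by rewrite (bigD1 (true, i)) //= iA.
Qed.

(** [k] is the fuel: degrees lie above D - k and are at most [D] by [degree_leq_total], so
    [long D 0] forces 0. *)
Definition long D k h := forall m, m \in msupp h ->
  (total_multiplicity m <= D)%N /\ (D < degree m + k)%N.

Lemma long0 D k : long D k 0.
Proof. by move=> m; rewrite msupp0. Qed.

Lemma longD D k g h : long D k g -> long D k h -> long D k (g + h).
Proof. by move=> Lg Lh m /msuppD_le; rewrite mem_cat => /orP[/Lg|/Lh]. Qed.

Lemma longZ D k a h : long D k h -> long D k (a *: h).
Proof. by move=> Lh m /msuppZ_le /Lh. Qed.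

(** Modulo the minors, every monomial of lowest degree is replaced by a representative of its
    multidegree. The representatives cancel, which leaves a vanishing polynomial with one unit of
    fuel less. *)
Lemma vanishing_long D k g : long D k g -> vanishing_ideal V (theta g) ->
  J (theta g).
Proof.
elim: k g => [|k IH] g gl gV.
  have -> : g = 0.
    apply: msuppnil0; case E: (msupp g) => [//|m s].
    have [|] := gl m; first by rewrite E mem_head.
    rewrite addn0 => mD; rewrite ltnNge (leq_trans _ mD) //.
    exact: degree_leq_total.
  by rewrite rmorph0; apply: ideal_gen0.
(* The least degree that [long D k.+1] permits; the subtraction truncates to 0 for [k] at least
   [D]. *)
pose L := (D - k)%N; pose S := [seq m <- msupp g | degree m == L].
have gL : {in msupp g, forall m, (L <= degree m)%N}.
  by move=> m /gl[_]; rewrite addnS ltnS leq_subLR addnC.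
(* As finite functions, multidegrees have decidable equality, so [index] can pick a
   representative. *)
pose cls m := [ffun j => multiplicity j m].
pose rep (c : {ffun bool * 'I_n -> nat}) := nth 0%MM S (index c (map cls S)).
have clsP m m' : cls m = cls m' -> (multiplicity (n:=n))^~ m =1 (multiplicity (n:=n))^~ m'.
  by move=> /ffunP e j; have := e j; rewrite !ffunE.
have repS m : m \in S -> rep (cls m) \in S /\ cls (rep (cls m)) = cls m.
  move=> mS; have cS := map_f cls mS.
  have iS : (index (cls m) (map cls S) < size S)%N by rewrite -(size_map cls) index_mem.
  by split; [exact: mem_nth | rewrite -(nth_map _ (cls m)) // nth_index].
pose Q p := exists2 h, J (theta h) & long D k (p - h).
have QD p q : Q p -> Q q -> Q (p + q).
  move=> [h Jh lh] [h' Jh' lh']; exists (h + h').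
    by rewrite rmorphD; apply: ideal_genD.
  by rewrite opprD addrACA; apply: longD.
have [h Jh lh] : Q (\sum_(m <- S) g@_m *: ('X_[m] - 'X_[rep (cls m)])).
  rewrite big_seq; apply: big_ind => [|//|m mS].
    by exists 0; rewrite ?rmorph0 ?subrr; [apply: ideal_gen0 | apply: long0].
  have [rS rc] := repS m mS.
  move: (mS) (rS); rewrite !mem_filter => /andP[/eqP mL mg] /andP[/eqP rL _].
  have [h Jh hd] : exists2 h, J (theta h) &
      deep ((multiplicity (n:=n))^~ m) (degree m).+1 ('X_[m] - 'X_[rep (cls m)] - h).
    by apply: monomial_straighten; [apply: clsP | rewrite mL].
  exists (g@_m *: h).
    by rewrite linearZ /= -mul_mpolyC; apply: ideal_genM.
  rewrite -scalerBr; apply: longZ => m' /hd[mm' dm'].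
  split; last by move: dm'; rewrite mL /L; clear; lia.
  rewrite /total_multiplicity; under eq_bigr => j _ do rewrite mm'.
  by have [] := gl m mg.
have rep0 : \sum_(m <- S) g@_m *: 'X_[rep (cls m)] = 0 :> P.
  apply: (sum_by_class (fun c => 'X_[rep c] : P)) => c.
  rewrite big_filter_cond -[RHS](lowest_class_sum c n_gt0 gV gL).
  apply: eq_bigl => m; congr (_ && _).
  apply/eqP/forallP => [<- j|e]; first by rewrite ffunE.
  by apply/ffunP => j; rewrite ffunE (eqP (e j)).
have gh : long D k (g - h).
  have -> : g - h = (\sum_(m <- S) g@_m *: ('X_[m] - 'X_[rep (cls m)]) - h) +
      \sum_(m <- msupp g | degree m != L) g@_m *: 'X_[m].
    under [in RHS]eq_bigr => m _ do rewrite scalerBr.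
    rewrite sumrB rep0 subr0 addrAC; congr (_ - _).
    by rewrite {1}[g]mpolyE (bigID (fun m => degree m == L)) /= big_filter.
  apply: longD => //; rewrite big_seq_cond; apply: big_ind.
  - exact: long0.
  - exact: longD.
  move=> m /andP[mg mL]; apply: longZ => m'; rewrite msuppX inE => /eqP ->.
  have [mD _] := gl m mg; split=> //.
  by have := gL m mg; move: mL; rewrite /L; clear; lia.
(* [theta (g - h)] still vanishes, because [theta h] lies in the ideal of minors. *)
rewrite -(subrK h g) rmorphD; apply: ideal_genD => //.
apply: IH => // z zV; rewrite rmorphB /evalp mevalB.
have hV := ideal_gen_vanishing Jh zV.
by rewrite [X in _ - X]hV subr0; apply: gV.
Qed.

Lemma vanishing_ideal_gen f : vanishing_ideal V f -> J f.
Proof.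
have [g <-] := theta_surj f => gV.
pose D := \max_(m <- msupp g) total_multiplicity m.
(* With fuel [D.+1] the lower bound on degrees is vacuous. *)
apply: (@vanishing_long D D.+1) => // m mg; split; last by rewrite addnS ltnS leq_addl.
by rewrite /D (big_rem m) //= leq_maxl.
Qed.

End Generation.

Theorem theorem6p4 (R : realType) (n : nat) (hn : (2 <= n)%N)
    (f : {mpoly R[i][#|{: nonempty_subset n}|]}) :
  ideal_gen (@flattening_minor3 R[i] n) f <->
  vanishing_ideal (@affine_secant R[i] n) f.
Proof.
split; first exact: ideal_gen_vanishing.
exact: (@vanishing_ideal_gen R[i] n (ltnW hn)).
Qed.
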